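(* Let $(X,d)$ be a cone metric space, let $r_1,r_2\in E$ be such that each $r_i$ satisfies $0\ll r_i$ or $r_i=0$, and suppose $r_1<r_2$. If a sequence $\{x_n\}$ in $X$ is $r_1$-convergent to $x$ in $(X,d)$, then $\{x_n\}$ is also $r_2$-convergent to $x$ in $(X,d)$.
   Context: Let $E$ be a real Banach space. A subset $P\subset E$ is a cone if (i) $P$ is closed, nonempty and $P\neq\{0\}$; (ii) $a,b\in\mathbb{R}$, $a,b\ge 0$, $x,y\in P$ implies $ax+by\in P$; (iii) $x\in P$ and $-x\in P$ implies $x=0$. Write $x\le y$ if $y-x\in P$, $x<y$ if $x\le y$ and $x\ne y$, and $x\ll y$ if $y-x\in \mathrm{int}\,P$ (the interior of $P$). A cone metric space $(X,d)$ (associated with $E$ and $P$) is a nonempty set $X$ with a map $d:X\times X\to E$ such that for all $x,y,z\in X$: $0\le d(x,y)$, and $d(x,y)=0$ iff $x=y$; $d(x,y)=d(y,x)$; $d(x,y)\le d(x,z)+d(z,y)$. For $r\in E$ with $0\ll r$ or $r=0$, a sequence $\{x_n\}$ in $X$ is $r$-convergent to $x\in X$ if for every $\epsilon\in E$ with $0\ll\epsilon$ there is $k\in\mathbb{N}$ such that $d(x_n,x)\ll r+\epsilon$ for all $n\ge k$. *)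

(* Defs.v *)
From mathcomp Require Import all_boot all_order all_algebra.
From mathcomp Require Import boolp classical_sets reals topology normedtype.

Set Implicit Arguments.
Unset Strict Implicit.
Unset Printing Implicit Defensive.

Import GRing.Theory Num.Theory.
Import numFieldNormedType.Exports.

Local Open Scope classical_set_scope.
Local Open Scope ring_scope.

Record is_cone (R : realType) (E : completeNormedModType R) (P : set E) : Prop :=
  IsCone {
    cone_closed : closed P;
    cone_nonempty : P !=set0;
    cone_neq0 : P <> [set 0];
    cone_comb : forall (a b : R) (x y : E),
      0 <= a -> 0 <= b -> P x -> P y -> P (a *: x + b *: y);
    cone_pointed : forall x : E, P x -> P (- x) -> x = 0
  }.

Definition cone_le (R : realType) (E : completeNormedModType R) (P : set E)
  (x y : E) : Prop := P (y - x).

Definition cone_lt (R : realType) (E : completeNormedModType R) (P : set E)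
  (x y : E) : Prop := cone_le P x y /\ x <> y.

Definition cone_ll (R : realType) (E : completeNormedModType R) (P : set E)
  (x y : E) : Prop := interior P (y - x).

Record is_cone_metric (R : realType) (E : completeNormedModType R) (P : set E)
    (X : Type) (d : X -> X -> E) : Prop :=
  IsConeMetric {
    cone_metric_nonempty : inhabited X;
    cone_metric_ge0 : forall x y : X, cone_le P 0 (d x y);
    cone_metric_eq0 : forall x y : X, d x y = 0 <-> x = y;
    cone_metric_sym : forall x y : X, d x y = d y x;
    cone_metric_triangle : forall x y z : X,
      cone_le P (d x y) (d x z + d z y)
  }.

Definition r_convergent (R : realType) (E : completeNormedModType R) (P : set E)
    (X : Type) (d : X -> X -> E) (r : E) (u : nat -> X) (x : X) : Prop :=
  forall eps : E, cone_ll P 0 eps ->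
    exists k : nat, forall n : nat, (k <= n)%N -> cone_ll P (d (u n) x) (r + eps).

(* Main.v *)
Require Import Defs.
From mathcomp Require Import all_boot all_order all_algebra.
From mathcomp Require Import boolp classical_sets reals topology normedtype.

Local Open Scope ring_scope.

Import GRing.Theory Num.Theory.
Import numFieldNormedType.Exports.

(** Passing from [r1] to [r2] adds [r2 - r1], a point of [P], to [r1 + eps - d (u n) x], which is
    interior to [P] for large [n]. Since int P + P lies in int P ([cone_interior_add]), the same [k]
    serves for [r2]. *)

Lemma cone_add (R : realType) (E : completeNormedModType R) (P : set E)
    (hP : is_cone P) (x y : E) : P x -> P y -> P (x + y).
Proof.
by move=> Px Py; have := cone_comb hP ler01 ler01 Px Py; rewrite !scale1r.
Qed.

(** Translation by [- y] is continuous and sends [x + y] to [x], so [z - y] is in [P] for all [z]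
    near [x + y]; then so is [z = (z - y) + y]. *)
Lemma cone_interior_add (R : realType) (E : completeNormedModType R)
    (P : set E) (hP : is_cone P) (x y : E) :
  interior P x -> P y -> interior P (x + y).
Proof.
move=> Px Py.
have cont : {for x + y, continuous (fun z : E => z - y)}.
  by apply: cvgB; [exact: cvg_id | exact: cvg_cst].
(* Pulling back along [cont] leaves [P] as a neighbourhood of [x + y - y], which is [Px]. *)
have : nbhs (x + y) (fun z => P (z - y)) by apply: cont; rewrite addrK.
by apply: filterS => z Pzy; rewrite -(subrK y z); exact: cone_add.
Qed.

Theorem theorem3p5 (R : realType) (E : completeNormedModType R) (P : set E)
    (hP : is_cone P) (X : Type) (d : X -> X -> E) (hd : is_cone_metric P d)
    (r1 r2 : E) (hr1 : cone_ll P 0 r1 \/ r1 = 0) (hr2 : cone_ll P 0 r2 \/ r2 = 0)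
    (hr12 : cone_lt P r1 r2) (u : nat -> X) (x : X) :
  r_convergent P d r1 u x -> r_convergent P d r2 u x.
Proof.
move=> cv eps /cv[k hk]; exists k => n /hk lt1.
have [le12 _] := hr12.
rewrite /cone_ll.
have -> : r2 + eps - d (u n) x = (r1 + eps - d (u n) x) + (r2 - r1).
  by rewrite [RHS]addrC -!addrA addKr.
exact: cone_interior_add.
Qed.
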